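(* Let $R$ be a unital commutative ring, let $n\ge1$, and let $N$ be an $R$-module. Suppose $$F_n\xrightarrow{\alpha_n}F_{n-1}\to\cdots\to F_0\to N\to0\qquad\text{and}\qquad G_n\xrightarrow{\beta_n}G_{n-1}\to\cdots\to G_0\to N\to0$$ are two sequences, with all $F_i,G_i$ finitely generated free $R$-modules, exact except possibly at $F_n$ and $G_n$. Then the leftmost maps $\alpha_n\colon F_n\to F_{n-1}$ and $\beta_n\colon G_n\to G_{n-1}$ are freely stably $R$-equivalent: $\alpha_n\sim_{R,\mathrm{st}}\beta_n$.
   Context: Maps between finitely generated free modules are identified with matrices over $R$ after choosing bases. Matrices $\varphi,\varphi'\in M_{q\times a}(R)$ are $R$-equivalent ($\varphi\sim_R\varphi'$) if $\Xi\varphi\Phi=\varphi'$ for some $\Xi\in\operatorname{GL}_q(R)$, $\Phi\in\operatorname{GL}_a(R)$. Matrices $\varphi,\varphi'$ of possibly different sizes are freely stably $R$-equivalent ($\varphi\sim_{R,\mathrm{st}}\varphi'$) if there are integers $\alpha,\beta,\eta,\alpha',\beta',\eta'\ge0$ with $\varphi\oplus I_\alpha\oplus0_{\beta,\eta}\sim_R\varphi'\oplus I_{\alpha'}\oplus0_{\beta',\eta'}$, where $0_{\beta,\eta}$ is the $\beta\times\eta$ zero matrix ($\beta$ or $\eta$ may be $0$). *)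

(* Defs.v *)
(* Mathematical Components. *)
From HB Require Import structures.
From mathcomp Require Import all_boot all_order all_algebra.

Set Implicit Arguments.
Unset Strict Implicit.
Unset Printing Implicit Defensive.

Import GRing.Theory.
Local Open Scope ring_scope.

(* [comPzRingType] (which, unlike [comNzRingType], includes the zero ring)
   carries no decidable units, so [unitmx] is not available over it. *)
Definition in_GL (R : comPzRingType) (q : nat) (X : 'M[R]_q) : Prop :=
  exists Y : 'M[R]_q, X *m Y = 1%:M /\ Y *m X = 1%:M.

Definition R_equiv (R : comPzRingType) (q a : nat) (A B : 'M[R]_(q, a)) : Prop :=
  exists (X : 'M[R]_q) (Y : 'M[R]_a),
    [/\ in_GL X, in_GL Y & X *m A *m Y = B].

Definition dsum_mx (R : comPzRingType) (q a q' a' : nat)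
    (A : 'M[R]_(q, a)) (B : 'M[R]_(q', a')) : 'M[R]_(q + q', a + a') :=
  block_mx A 0 0 B.

Definition stabilize_mx (R : comPzRingType) (q a : nat) (A : 'M[R]_(q, a))
    (al be et : nat) : 'M[R]_(q + al + be, a + al + et) :=
  dsum_mx (dsum_mx A (1%:M : 'M[R]_al)) (0 : 'M[R]_(be, et)).

(* [er] and [ec] assert that the two stabilized matrices have the same size. *)
Definition freely_stably_equiv_mx (R : comPzRingType) (q a q' a' : nat)
    (A : 'M[R]_(q, a)) (B : 'M[R]_(q', a')) : Prop :=
  exists (al be et al' be' et' : nat)
         (er : (q + al + be = q' + al' + be')%N)
         (ec : (a + al + et = a' + al' + et')%N),
    R_equiv (castmx (er, ec) (stabilize_mx A al be et))
            (stabilize_mx B al' be' et').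

Definition is_basis (R : comPzRingType) (M : lmodType R) (m : nat)
    (b : 'I_m -> M) : Prop :=
  (forall x : M, exists c : 'I_m -> R, x = \sum_(i < m) c i *: b i) /\
  (forall c : 'I_m -> R, \sum_(i < m) c i *: b i = 0 -> forall i, c i = 0).

Definition fg_free (R : comPzRingType) (M : lmodType R) : Prop :=
  exists (m : nat) (b : 'I_m -> M), is_basis b.

(* Column convention: column [j] of [A] holds the coordinates of [f (b j)], so
   that a map from a module of rank [a] to one of rank [q] has a matrix of size
   [q] x [a]. *)
Definition is_matrix_of (R : comPzRingType) (M M' : lmodType R) (a q : nat)
    (b : 'I_a -> M) (b' : 'I_q -> M') (f : {linear M -> M'})
    (A : 'M[R]_(q, a)) : Prop :=
  forall j : 'I_a, f (b j) = \sum_(i < q) A i j *: b' i.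

(* Required for every choice of bases; used only between finitely generated
   free modules, for which bases (and hence matrices) exist. *)
Definition freely_stably_equiv (R : comPzRingType) (M M' P P' : lmodType R)
    (f : {linear M -> M'}) (g : {linear P -> P'}) : Prop :=
  forall (a q c r : nat)
         (bM : 'I_a -> M) (bM' : 'I_q -> M') (bP : 'I_c -> P) (bP' : 'I_r -> P')
         (A : 'M[R]_(q, a)) (B : 'M[R]_(r, c)),
    is_basis bM -> is_basis bM' -> is_basis bP -> is_basis bP' ->
    is_matrix_of bM bM' f A -> is_matrix_of bP bP' g B ->
    freely_stably_equiv_mx A B.

Definition exact_at (R : comPzRingType) (L M P : lmodType R)
    (f : {linear L -> M}) (g : {linear M -> P}) : Prop :=
  forall y : M, g y = 0 <-> exists x : L, f x = y.

(* F n -> F n.-1 -> ... -> F 0 -> N -> 0, exact except possibly at F n (for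
   0 < n).  The map F k -> F k.-1 is [d k.-1]; the modules [F i] with n < i and
   the maps [d i] with n <= i play no role. *)
Definition truncated_free_resolution (R : comPzRingType) (n : nat)
    (N : lmodType R) (F : nat -> lmodType R)
    (d : forall i : nat, {linear F i.+1 -> F i}) (eps : {linear F 0%N -> N}) : Prop :=
  [/\ forall i : nat, (i <= n)%N -> fg_free (F i),
      forall y : N, exists x : F 0%N, eps x = y,
      exact_at (d 0%N) eps
    & forall i : nat, (i.+1 < n)%N -> exact_at (d i.+1) (d i)].

(* Main.v *)
(* Two matrices C, D with the same image satisfy C = D X and D = C Y, so
   [C, 0] and [D, 0] are both equivalent to [C, D].  For n = 1 this applies to
   the two enlargements of the presentation matrices which generate the kernel
   of F_0 + G_0 -> N.  For the induction, the kernel of a stabilization of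
   alpha_i is the image of alpha_{i+1} + 0_{al,0} + I_et; an equivalence
   between stabilizations of alpha_i and beta_i carries one kernel to the other,
   so the same remark shows that alpha_{i+1} and beta_{i+1} are stably
   equivalent.  No chain maps are needed. *)
Require Import Defs.
From HB Require Import structures.
From mathcomp Require Import all_boot all_order all_algebra.

Set Implicit Arguments.
Unset Strict Implicit.
Unset Printing Implicit Defensive.

Import GRing.Theory.
Local Open Scope ring_scope.

Section MatrixEquivalence.
Context {R : comPzRingType}.

(** * Equivalence of matrices by rectangular invertible factors *)

Definition mutual_inverse m n (X : 'M[R]_(m, n)) (X' : 'M[R]_(n, m)) : Prop :=
  X *m X' = 1%:M /\ X' *m X = 1%:M.

(* Rectangular invertible factors make casts unnecessary; the equalities of
   sizes have to be recorded because they can fail over the zero ring. *)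
Definition equivmx q a q' a' (A : 'M[R]_(q, a)) (B : 'M[R]_(q', a')) : Prop :=
  [/\ q = q', a = a' & exists X X' Y Y',
    [/\ @mutual_inverse q' q X X', @mutual_inverse a a' Y Y'
      & X *m A *m Y = B]].

Lemma mutual_inverse1 n : mutual_inverse (1%:M : 'M[R]_n) 1%:M.
Proof. by split; rewrite mulmx1. Qed.

Lemma mutual_inverse_sym m n (X : 'M[R]_(m, n)) X' :
  mutual_inverse X X' -> mutual_inverse X' X.
Proof. by case. Qed.

Lemma mutual_inverse_mul m n p (X : 'M[R]_(m, n)) X' (Y : 'M[R]_(n, p)) Y' :
  mutual_inverse X X' -> mutual_inverse Y Y' ->
  mutual_inverse (X *m Y) (Y' *m X').
Proof.
move=> [XX' X'X] [YY' Y'Y]; split.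
  by rewrite mulmxA -(mulmxA X) YY' mulmx1.
by rewrite mulmxA -(mulmxA Y') X'X mulmx1.
Qed.

Lemma mutual_inverse_dsum m n p r (X : 'M[R]_(m, n)) X' (Y : 'M[R]_(p, r)) Y' :
  mutual_inverse X X' -> mutual_inverse Y Y' ->
  mutual_inverse (dsum_mx X Y) (dsum_mx X' Y').
Proof.
move=> [XX' X'X] [YY' Y'Y]; rewrite /dsum_mx; split.
  by rewrite mulmx_block !mulmx0 !mul0mx !addr0 add0r XX' YY' -scalar_mx_block.
by rewrite mulmx_block !mulmx0 !mul0mx !addr0 add0r X'X Y'Y -scalar_mx_block.
Qed.

Lemma mutual_inverse_swap m n :
  mutual_inverse (block_mx 0 1%:M 1%:M 0 : 'M[R]_(m + n, n + m))
                 (block_mx 0 1%:M 1%:M 0).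
Proof.
split; rewrite mulmx_block !mulmx0 !mul0mx !mulmx1 !addr0 !add0r;
  by rewrite -scalar_mx_block.
Qed.

(** Elementary block operations: acting on columns for matrices with the same image, and on rows in
    [equivmx_triangular]. *)
Lemma mutual_inverse_unitriangular m n (u : 'M[R]_(m, n)) :
  mutual_inverse (block_mx 1%:M u 0 1%:M) (block_mx 1%:M (- u) 0 1%:M).
Proof.
split; rewrite mulmx_block !mulmx0 !mul0mx !mulmx1 !mul1mx !addr0 !add0r;
  by rewrite ?addNr ?subrr -scalar_mx_block.
Qed.

Lemma equivmx_refl q a (A : 'M[R]_(q, a)) : equivmx A A.
Proof.
split=> //; exists 1%:M, 1%:M, 1%:M, 1%:M.
by rewrite mulmx1 mul1mx; split=> //; exact: mutual_inverse1.
Qed.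

Lemma equivmx_sym q a q' a' (A : 'M[R]_(q, a)) (B : 'M[R]_(q', a')) :
  equivmx A B -> equivmx B A.
Proof.
case=> eq_q eq_a [X [X' [Y [Y' [iX iY <-]]]]]; split=> //.
exists X', X, Y', Y; split; try exact: mutual_inverse_sym.
by rewrite !mulmxA iX.2 mul1mx -mulmxA iY.1 mulmx1.
Qed.

Lemma equivmx_trans q a q' a' q'' a'' (B : 'M[R]_(q', a'))
    (A : 'M[R]_(q, a)) (C : 'M[R]_(q'', a'')) :
  equivmx A B -> equivmx B C -> equivmx A C.
Proof.
case=> eq_q eq_a [X [X' [Y [Y' [iX iY <-]]]]].
case=> eq_q' eq_a' [Z [Z' [T [T' [iZ iT <-]]]]].
split; [by rewrite eq_q | by rewrite eq_a |].
exists (Z *m X), (X' *m Z'), (Y *m T), (T' *m Y').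
by split; [exact: mutual_inverse_mul.. | rewrite !mulmxA].
Qed.

Lemma equivmx_mull m n (X X' : 'M[R]_m) (A : 'M[R]_(m, n)) :
  mutual_inverse X X' -> equivmx A (X *m A).
Proof.
move=> iX; split=> //; exists X, X', 1%:M, 1%:M.
by rewrite mulmx1; split=> //; exact: mutual_inverse1.
Qed.

Lemma equivmx_mulr m n (Y Y' : 'M[R]_n) (A : 'M[R]_(m, n)) :
  mutual_inverse Y Y' -> equivmx A (A *m Y).
Proof.
move=> iY; split=> //; exists 1%:M, 1%:M, Y, Y'.
by rewrite mul1mx; split=> //; exact: mutual_inverse1.
Qed.

Lemma equivmx_cast q a q' a' (e : (q = q') * (a = a')) (A : 'M[R]_(q, a)) :
  equivmx A (castmx e A).
Proof. by case: e => eq eq'; subst; exact: equivmx_refl. Qed.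

Lemma equivmx0 q a q' a' :
  q = q' -> a = a' -> equivmx (0 : 'M[R]_(q, a)) (0 : 'M[R]_(q', a')).
Proof. by move=> -> ->; exact: equivmx_refl. Qed.

Lemma equivmx_R_equiv q a q' a' (A : 'M[R]_(q, a)) (B : 'M[R]_(q', a')) :
  equivmx A B -> exists (er : q = q') (ec : a = a'), R_equiv (castmx (er, ec) A) B.
Proof.
case=> eq_q eq_a; subst q' a' => -[X [X' [Y [Y' [iX iY <-]]]]].
exists erefl, erefl, X, Y; split=> //; first by exists X'.
by exists Y'.
Qed.

Lemma R_equiv_equivmx q a q' a' (er : q = q') (ec : a = a')
    (A : 'M[R]_(q, a)) (B : 'M[R]_(q', a')) :
  R_equiv (castmx (er, ec) A) B -> equivmx A B.
Proof.
move=> [X [Y [[X' iX] [Y' iY] <-]]].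
apply: equivmx_trans (equivmx_cast (er, ec) A) _; split=> //.
by exists X, X', Y, Y'.
Qed.

(** * Direct sums and zero blocks *)

Lemma equivmx_dsum q a q' a' p b p' b' (A : 'M[R]_(q, a)) (A' : 'M[R]_(q', a'))
    (B : 'M[R]_(p, b)) (B' : 'M[R]_(p', b')) :
  equivmx A A' -> equivmx B B' -> equivmx (dsum_mx A B) (dsum_mx A' B').
Proof.
case=> eq_q eq_a [X [X' [Y [Y' [iX iY <-]]]]].
case=> eq_p eq_b [Z [Z' [T [T' [iZ iT <-]]]]].
split; [by rewrite eq_q eq_p | by rewrite eq_a eq_b |].
exists (dsum_mx X Z), (dsum_mx X' Z'), (dsum_mx Y T), (dsum_mx Y' T').
split; [exact: mutual_inverse_dsum.. |].
by rewrite /dsum_mx !mulmx_block !mulmx0 !mul0mx !addr0 !add0r !mul0mx.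
Qed.

Lemma equivmx_dsumC q a p b (A : 'M[R]_(q, a)) (B : 'M[R]_(p, b)) :
  equivmx (dsum_mx A B) (dsum_mx B A).
Proof.
split; [exact: addnC.. |].
exists (block_mx 0 1%:M 1%:M 0), (block_mx 0 1%:M 1%:M 0).
exists (block_mx 0 1%:M 1%:M 0), (block_mx 0 1%:M 1%:M 0).
split; [exact: mutual_inverse_swap.. |].
by rewrite /dsum_mx !mulmx_block !mulmx0 !mul0mx !mulmx1 !mul1mx !addr0 !add0r.
Qed.

Lemma equivmx_dsumA q a p b r c (A : 'M[R]_(q, a)) (B : 'M[R]_(p, b))
    (C : 'M[R]_(r, c)) :
  equivmx (dsum_mx A (dsum_mx B C)) (dsum_mx (dsum_mx A B) C).
Proof.
apply: equivmx_sym; rewrite /dsum_mx.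
(* Reassociating the blocks costs only a cast of sizes, which [equivmx_cast] absorbs. *)
have := @block_mxA _ q p r a b c A 0 0 0 B 0 0 0 C.
rewrite /= !row_mx0 !col_mx0 => ->; exact: equivmx_cast.
Qed.

Lemma dsum_mx0 q a p b : dsum_mx (0 : 'M[R]_(q, a)) (0 : 'M[R]_(p, b)) = 0.
Proof. by rewrite /dsum_mx block_mx0. Qed.

(** Since [q + 0] is not convertible to [q], the left factor is an identity with an empty block
    below it. *)
Lemma equivmx_row_mx0 q a k (A : 'M[R]_(q, a)) :
  equivmx (row_mx A (0 : 'M_(q, k))) (dsum_mx A (0 : 'M_(0, k))).
Proof.
split=> //; first by rewrite addn0.
exists (col_mx 1%:M 0), (row_mx 1%:M 0), 1%:M, 1%:M; split.
- split; last by rewrite mul_row_col mulmx1 mul0mx addr0.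
  rewrite mul_col_row !mulmx1 !mul0mx mulmx0 scalar_mx_block.
  by congr block_mx; rewrite [RHS]flatmx0.
- exact: mutual_inverse1.
rewrite mulmx1 mul_col_mx mul1mx mul0mx /dsum_mx /block_mx.
by congr col_mx; rewrite [RHS]flatmx0.
Qed.

(** * Matrices with the same image *)

Lemma mulmx_factor m k l (C : 'M[R]_(m, k)) (D : 'M[R]_(m, l)) :
  (forall w : 'cV_k, exists u : 'cV_l, C *m w = D *m u) ->
  exists X, C = D *m X.
Proof.
move=> sCD.
(* The hypothesis on the [j]-th standard vector yields the [j]-th column of [X]; choice over a
   finite index type is constructive. *)
have [f fP] := fin_all_exists (fun j => sCD (delta_mx j 0)).
exists (\matrix_(i, j) f j i 0); apply/matrixP=> i j.
have /matrixP/(_ i 0) := fP j; rewrite -colE !mxE => ->.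
by apply: eq_bigr => s _; rewrite mxE.
Qed.

(* Both are equivalent to [row_mx C D]. *)
Lemma equivmx_same_image m k l (C : 'M[R]_(m, k)) (D : 'M[R]_(m, l)) :
  (forall w : 'cV_k, exists u : 'cV_l, C *m w = D *m u) ->
  (forall u : 'cV_l, exists w : 'cV_k, D *m u = C *m w) ->
  equivmx (row_mx C (0 : 'M_(m, l))) (row_mx D (0 : 'M_(m, k))).
Proof.
have half k1 l1 (C1 : 'M[R]_(m, k1)) (D1 : 'M[R]_(m, l1)) :
    (forall u : 'cV_l1, exists w : 'cV_k1, D1 *m u = C1 *m w) ->
    equivmx (row_mx C1 (0 : 'M_(m, l1))) (row_mx C1 D1).
  move=> /mulmx_factor[Y ->].
  (* With [D1] now written [C1 *m Y], a column operation adds it to the zero block. *)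
  have := equivmx_mulr (row_mx C1 (0 : 'M_(m, l1))) (mutual_inverse_unitriangular Y).
  by rewrite mul_row_block !mulmx1 !mul0mx !addr0.
move=> /half DC /half CD.
apply: equivmx_trans CD _; apply: equivmx_trans (equivmx_sym DC).
split=> //; first exact: addnC.
exists 1%:M, 1%:M, (block_mx 0 1%:M 1%:M 0), (block_mx 0 1%:M 1%:M 0).
split; [exact: mutual_inverse1 | exact: mutual_inverse_swap |].
by rewrite mul1mx mul_row_block !mulmx0 !mulmx1 addr0 add0r.
Qed.

(** * Stable equivalence and its passage to kernels *)

Definition stably_equivmx q a q' a' (A : 'M[R]_(q, a)) (B : 'M[R]_(q', a')) :=
  exists al be et al' be' et',
    equivmx (stabilize_mx A al be et) (stabilize_mx B al' be' et').

Lemma freely_stably_equiv_mxE q a q' a' (A : 'M[R]_(q, a)) (B : 'M[R]_(q', a')) :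
  freely_stably_equiv_mx A B <-> stably_equivmx A B.
Proof.
split=> [[al [be [et [al' [be' [et' [er [ec eAB]]]]]]]] |
         [al [be [et [al' [be' [et' /equivmx_R_equiv[er [ec eAB]]]]]]]]].
  by exists al, be, et, al', be', et'; exact: R_equiv_equivmx eAB.
by exists al, be, et, al', be', et', er, ec.
Qed.

Definition exact_mx m n p (A : 'M[R]_(m, n)) (B : 'M[R]_(n, p)) : Prop :=
  forall v : 'cV_n, A *m v = 0 <-> exists w, B *m w = v.

Lemma exact_mx_dsum m n p m' n' p' (A : 'M[R]_(m, n)) (B : 'M[R]_(n, p))
    (A' : 'M[R]_(m', n')) (B' : 'M[R]_(n', p')) :
  exact_mx A B -> exact_mx A' B' -> exact_mx (dsum_mx A A') (dsum_mx B B').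
Proof.
rewrite /dsum_mx => exA exA' v; rewrite -[v]vsubmxK.
rewrite mul_block_col !mul0mx addr0 add0r; split.
  rewrite -col_mx0 => /eq_col_mx[/exA[w <-] /exA'[w' <-]].
  by exists (col_mx w w'); rewrite mul_block_col !mul0mx addr0 add0r.
case=> w; rewrite -[w]vsubmxK mul_block_col !mul0mx addr0 add0r.
move=> /eq_col_mx[ew ew'].
have -> : A *m usubmx v = 0 by apply/exA; eexists; exact: ew.
have -> : A' *m dsubmx v = 0 by apply/exA'; eexists; exact: ew'.
by rewrite col_mx0.
Qed.

Lemma exact_mx10 n : exact_mx (1%:M : 'M[R]_n) (0 : 'M_(n, 0)).
Proof.
move=> v; rewrite mul1mx; split=> [-> | [w <-]]; last by rewrite mul0mx.
by exists 0; rewrite mulmx0.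
Qed.

Lemma exact_mx01 m n : exact_mx (0 : 'M[R]_(m, n)) 1%:M.
Proof.
by move=> v; rewrite mul0mx; split=> // _; exists v; rewrite mul1mx.
Qed.

(** The stabilizing summands exchange roles: [I_al] has trivial kernel, giving [0_{al,0}], while the
    zero block with [et] columns kills everything, giving [I_et]. *)
Definition stabilized_kernel n p (B : 'M[R]_(n, p)) al et :
    'M[R]_(n + al + et, p + 0 + et) :=
  dsum_mx (dsum_mx B (0 : 'M_(al, 0))) (1%:M : 'M_et).

Lemma exact_mx_stabilize m n p (A : 'M[R]_(m, n)) (B : 'M[R]_(n, p)) al be et :
  exact_mx A B -> exact_mx (stabilize_mx A al be et) (stabilized_kernel B al et).
Proof.
move=> exAB; apply: exact_mx_dsum; last exact: exact_mx01.
by apply: exact_mx_dsum; last exact: exact_mx10.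
Qed.

(** The [al] zero rows and [k] zero columns merge into one [al] by [k] zero block, so reordering the
    summands gives a stabilization of [B] with identity block [I_et]. *)
Lemma equivmx_stabilized_kernel n p (B : 'M[R]_(n, p)) al et k :
  equivmx (row_mx (stabilized_kernel B al et) (0 : 'M_(_, k)))
          (stabilize_mx B et al k).
Proof.
apply: equivmx_trans (equivmx_row_mx0 _ _) _.
apply: equivmx_trans (equivmx_sym (equivmx_dsumA _ _ _)) _.
apply: equivmx_trans (equivmx_sym (equivmx_dsumA _ _ _)) _.
apply: equivmx_trans (equivmx_dsumA _ _ _).
apply: equivmx_dsum (equivmx_refl _) _.
apply: equivmx_trans (equivmx_dsumC _ _) _.
apply: equivmx_trans (equivmx_sym (equivmx_dsumA _ _ _)) _.
apply: equivmx_dsum (equivmx_refl _) _.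
by rewrite dsum_mx0; apply: equivmx0; rewrite ?addn0 ?add0n.
Qed.

(** The left factor preserves the kernel, and the right factor [Y] moves it by its inverse [Y']. *)
Lemma exact_mx_transport m n p m' n' (A : 'M[R]_(m, n)) (B : 'M[R]_(n, p))
    (X : 'M[R]_(m', m)) X' (Y : 'M[R]_(n, n')) Y' :
  mutual_inverse X X' -> mutual_inverse Y Y' ->
  exact_mx A B -> exact_mx (X *m A *m Y) (Y' *m B).
Proof.
move=> [_ X'X] [YY' Y'Y] exAB v; split=> [XAYv0 | [w <-]].
  have /exAB[w Bw] : A *m (Y *m v) = 0.
    rewrite -[LHS]mul1mx -X'X -mulmxA (mulmxA X) (mulmxA (X *m A)).
    by rewrite XAYv0 mulmx0.
  by exists w; rewrite -mulmxA Bw mulmxA Y'Y mul1mx.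
have /exAB ABw : exists w', B *m w' = B *m w by exists w.
by rewrite -!mulmxA (mulmxA Y) YY' mul1mx ABw mulmx0.
Qed.

Lemma exact_mx_same_image m n p p' (A : 'M[R]_(m, n)) (B : 'M[R]_(n, p))
    (B' : 'M[R]_(n, p')) :
  exact_mx A B -> exact_mx A B' ->
  equivmx (row_mx B (0 : 'M_(n, p'))) (row_mx B' (0 : 'M_(n, p))).
Proof.
move=> exB exB'; apply: equivmx_same_image => w.
  have /exB/exB'[u <-] : exists w', B *m w' = B *m w by exists w.
  by exists u.
have /exB'/exB[u <-] : exists w', B' *m w' = B' *m w by exists w.
by exists u.
Qed.

Lemma stably_equivmx_next m n p m' n' p' (A : 'M[R]_(m, n)) (B : 'M[R]_(n, p))
    (A' : 'M[R]_(m', n')) (B' : 'M[R]_(n', p')) :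
  exact_mx A B -> exact_mx A' B' ->
  stably_equivmx A A' -> stably_equivmx B B'.
Proof.
move=> exAB exAB' [al [be [et [al' [be' [et' eAA']]]]]].
have exs := @exact_mx_stabilize _ _ _ _ _ al be et exAB.
have exs' := @exact_mx_stabilize _ _ _ _ _ al' be' et' exAB'.
(* Each kernel matrix is padded with as many zero columns as the other one has columns, as
   [exact_mx_same_image] requires. *)
exists et, al, (p' + 0 + et')%N, et', al', (p + 0 + et)%N.
apply: equivmx_trans (equivmx_sym (equivmx_stabilized_kernel _ _ _ _)) _.
apply: equivmx_trans (equivmx_stabilized_kernel _ _ _ _).
case: eAA' => _ eq_n [X [X' [Y [Y' [iX iY eXY]]]]].
(* Both [Y' *m stabilized_kernel B al et] and [stabilized_kernel B' al' et'] now generate the kernel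
   of one matrix. *)
move: exs'; rewrite -eXY => exs'.
have := exact_mx_same_image (exact_mx_transport iX iY exs) exs'.
apply: equivmx_trans; split=> //.
exists Y', Y, 1%:M, 1%:M.
split; [exact: mutual_inverse_sym | exact: mutual_inverse1 |].
by rewrite mulmx1 mul_mx_row mulmx0.
Qed.

(** * Two presentations of the same module *)

Lemma lift_mx (N : lmodType R) q r (phi : {linear 'cV[R]_q -> N})
    (psi : {linear 'cV[R]_r -> N}) :
  (forall y, exists v, phi v = y) ->
  exists u : 'M_(q, r), forall v, phi (u *m v) = psi v.
Proof.
move=> surj_phi.
(* Projectivity of a free module: the columns of [u] are preimages under [phi] of the images under
   [psi] of the standard vectors. *)
have [f fP] := fin_all_exists (fun j : 'I_r => surj_phi (psi (delta_mx j 0))).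
exists (\matrix_(i, j) f j i 0) => v.
have -> : (\matrix_(i, j) f j i 0) *m v = \sum_j v j 0 *: f j.
  apply/matrixP=> i j; rewrite (ord1 j) mxE summxE; apply: eq_bigr => s _.
  by rewrite !mxE mulrC.
have {2}-> : v = \sum_j v j 0 *: delta_mx j 0.
  by rewrite {1}[v]matrix_sum_delta; apply: eq_bigr => s _; rewrite big_ord1.
by rewrite !linear_sum; apply: eq_bigr => s _; rewrite !linearZ /= fP.
Qed.

Definition presents (N : lmodType R) q a (phi : {linear 'cV[R]_q -> N})
    (A : 'M[R]_(q, a)) : Prop :=
  (forall y, exists v, phi v = y) /\
  (forall v, phi v = 0 <-> exists w, A *m w = v).

(** As [phi x + psi y = phi (x + u *m y)], the pair [(x, y)] lies in the kernel exactly when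
    [x = A *m w - u *m y] for some [w]. *)
Lemma presents_sum_image (N : lmodType R) q a r (phi : {linear 'cV[R]_q -> N})
    (psi : {linear 'cV[R]_r -> N}) (A : 'M[R]_(q, a)) (u : 'M[R]_(q, r)) :
  presents phi A -> (forall v, phi (u *m v) = psi v) ->
  forall v, phi (usubmx v) + psi (dsubmx v) = 0 <->
    exists w, block_mx A (- u) 0 1%:M *m w = v.
Proof.
move=> [_ kerA] phiu v; rewrite -phiu -linearD; split.
  move=> /kerA[w Aw]; exists (col_mx w (dsubmx v)).
  rewrite mul_block_col mul0mx mul1mx add0r mulNmx Aw addrK.
  exact: vsubmxK.
case=> w <-; rewrite -[w]vsubmxK mul_block_col col_mxKu col_mxKd.
rewrite mul0mx mul1mx add0r mulNmx subrK; apply/kerA.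
by exists (usubmx w).
Qed.

(** Adding [u] times the lower block row clears [- u]. *)
Lemma equivmx_triangular q a r (A : 'M[R]_(q, a)) (u : 'M[R]_(q, r)) :
  equivmx (block_mx A (- u) 0 1%:M) (dsum_mx A (1%:M : 'M_r)).
Proof.
have := equivmx_mull (block_mx A (- u) 0 1%:M) (mutual_inverse_unitriangular u).
by rewrite mulmx_block !mulmx0 !mul0mx !mul1mx mulmx1 !addr0 !add0r addNr.
Qed.

Lemma equivmx_row_mx0_congr q a q' a' k (A : 'M[R]_(q, a)) (B : 'M[R]_(q', a')) :
  equivmx A B -> equivmx (row_mx A (0 : 'M_(q, k))) (row_mx B (0 : 'M_(q', k))).
Proof.
move=> eAB; apply: equivmx_trans (equivmx_row_mx0 _ _) _.
apply: equivmx_trans (equivmx_sym (equivmx_row_mx0 _ _)).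
exact: equivmx_dsum (equivmx_refl _).
Qed.

(* With lifts [u], [v] between the free covers, [[A, -u; 0, 1]] and
   [[1, 0; -v, B]] both generate the kernel of the sum of the two covers. *)
Lemma presents_stably_equivmx (N : lmodType R) q a r c
    (phi : {linear 'cV[R]_q -> N}) (psi : {linear 'cV[R]_r -> N})
    (A : 'M[R]_(q, a)) (B : 'M[R]_(r, c)) :
  presents phi A -> presents psi B -> stably_equivmx A B.
Proof.
move=> presA presB.
have [u phiu] := lift_mx psi presA.1.
have [v psiv] := lift_mx phi presB.1.
have imC := presents_sum_image presA phiu.
have imD := presents_sum_image presB psiv.
set C := block_mx A (- u) 0 1%:M in imC *.
set D := block_mx B (- v) 0 1%:M in imD *.
(* [D] describes the kernel with the coordinates of [psi] first; [S] restores the order used by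
   [C]. *)
pose S : 'M[R]_(q + r, r + q) := block_mx 0 1%:M 1%:M 0.
have iS : mutual_inverse S _ := mutual_inverse_swap q r.
have Sw w : S *m w = col_mx (dsubmx w) (usubmx w).
  by rewrite -{1}[w]vsubmxK mul_block_col !mul0mx !mul1mx add0r addr0.
have imSD x : phi (usubmx x) + psi (dsubmx x) = 0 <-> exists w, S *m D *m w = x.
  split=> [x0 | [w <-]].
    have /imD[w Dw] : psi (usubmx (col_mx (dsubmx x) (usubmx x))) +
        phi (dsubmx (col_mx (dsubmx x) (usubmx x))) = 0.
      by rewrite col_mxKu col_mxKd addrC.
    by exists w; rewrite -mulmxA Dw Sw col_mxKu col_mxKd vsubmxK.
  rewrite -mulmxA Sw col_mxKu col_mxKd addrC; apply/imD.
  by exists w.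
(* The identity blocks come from [C] and [D]; the zero columns, [c + q] and [a + r], are the widths
   of [D] and [C] respectively. *)
exists r, 0%N, (c + q)%N, q, 0%N, (a + r)%N.
apply: equivmx_trans (equivmx_row_mx0 _ _).
apply: equivmx_trans (equivmx_sym (equivmx_row_mx0 _ _)) _.
apply: equivmx_trans (equivmx_row_mx0_congr _ (equivmx_sym (equivmx_triangular _ u))) _.
apply: equivmx_trans (equivmx_row_mx0_congr _ (equivmx_triangular _ v)).
apply: (equivmx_trans (B := row_mx (S *m D) 0)).
  apply: equivmx_same_image => w.
    have /imC/imSD[w' <-] : exists w', C *m w' = C *m w by exists w.
    by exists w'.
  have /imSD/imC[w' <-] : exists w', S *m D *m w' = S *m D *m w by exists w.
  by exists w'.
apply/equivmx_row_mx0_congr/equivmx_sym; split=> //; first exact: addnC.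
exists S, (block_mx 0 1%:M 1%:M 0), 1%:M, 1%:M.
by rewrite mulmx1; split=> //; exact: mutual_inverse1.
Qed.

End MatrixEquivalence.

(** * Passage from linear maps to matrices *)

Section Coordinates.
Context {R : comPzRingType}.

(** Taking column vectors as coordinates makes this a linear map on ['cV[R]_m], the kind of source
    that [presents] expects. *)
Definition lincomb (M : lmodType R) m (b : 'I_m -> M) (v : 'cV[R]_m) : M :=
  \sum_i v i 0 *: b i.

Lemma lincomb_is_linear (M : lmodType R) m (b : 'I_m -> M) : linear (lincomb b).
Proof.
move=> k x y; rewrite /lincomb scaler_sumr -big_split; apply: eq_bigr => i _.
by rewrite !mxE scalerDl scalerA.
Qed.

HB.instance Definition _ (M : lmodType R) m (b : 'I_m -> M) :=
  GRing.isLinear.Build R 'cV[R]_m M _ (lincomb b) (lincomb_is_linear b).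

Lemma is_basis_surj (M : lmodType R) m (b : 'I_m -> M) :
  is_basis b -> forall x, exists v, lincomb b v = x.
Proof.
case=> gen_b _ x; have [c ->] := gen_b x; exists (\col_i c i).
by apply: eq_bigr => i _; rewrite mxE.
Qed.

Lemma is_basis_eq0 (M : lmodType R) m (b : 'I_m -> M) v :
  is_basis b -> lincomb b v = 0 -> v = 0.
Proof.
case=> _ free_b /free_b v0; apply/matrixP=> i j.
by rewrite (ord1 j) v0 mxE.
Qed.

Lemma is_basis_inj (M : lmodType R) m (b : 'I_m -> M) :
  is_basis b -> injective (lincomb b).
Proof.
move=> basis_b x y exy; apply/eqP; rewrite -subr_eq0; apply/eqP.
by apply: is_basis_eq0 basis_b _; rewrite linearB /= exy subrr.
Qed.

Lemma is_matrix_of_lincomb (M M' : lmodType R) a q (b : 'I_a -> M)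
    (b' : 'I_q -> M') (f : {linear M -> M'}) A :
  is_matrix_of b b' f A -> forall v, f (lincomb b v) = lincomb b' (A *m v).
Proof.
move=> fA v; rewrite linear_sum.
under eq_bigr => j _ do rewrite linearZ /= fA scaler_sumr.
rewrite exchange_big; apply: eq_bigr => i _; rewrite mxE scaler_suml.
by apply: eq_bigr => j _; rewrite scalerA mulrC.
Qed.

Lemma is_matrix_of_exists (M M' : lmodType R) a q (b : 'I_a -> M)
    (b' : 'I_q -> M') (f : {linear M -> M'}) :
  is_basis b' -> exists A, is_matrix_of b b' f A.
Proof.
move=> basis_b'.
have [c cP] := fin_all_exists (fun j => basis_b'.1 (f (b j))).
exists (\matrix_(i, j) c j i) => j; rewrite cP.
by apply: eq_bigr => i _; rewrite mxE.
Qed.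

Lemma exact_at_mx (L M P : lmodType R) (f : {linear L -> M})
    (g : {linear M -> P}) l m p (bL : 'I_l -> L) (bM : 'I_m -> M)
    (bP : 'I_p -> P) A B :
  is_basis bL -> is_basis bM -> is_basis bP ->
  is_matrix_of bL bM f B -> is_matrix_of bM bP g A ->
  exact_at f g -> exact_mx A B.
Proof.
move=> basisL basisM basisP /is_matrix_of_lincomb fB /is_matrix_of_lincomb gA.
move=> exfg v; split=> [Av0 | [w <-]].
  have /exfg[x fx] : g (lincomb bM v) = 0 by rewrite gA Av0 linear0.
  have [w xE] := is_basis_surj basisL x.
  by exists w; apply: is_basis_inj basisM _ _ _; rewrite -fB xE.
apply: is_basis_eq0 basisP _; rewrite -gA; apply/exfg.
by exists (lincomb bL w); rewrite fB.
Qed.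

(** [N] may have no basis, so only [M] is put in coordinates and the augmentation remains a linear
    map. *)
Lemma exact_at_presents (L M N : lmodType R) (f : {linear L -> M})
    (eps : {linear M -> N}) l m (bL : 'I_l -> L) (bM : 'I_m -> M) A :
  is_basis bL -> is_basis bM -> is_matrix_of bL bM f A ->
  (forall y, exists x, eps x = y) -> exact_at f eps ->
  presents (eps \o lincomb bM) A.
Proof.
move=> basisL basisM /is_matrix_of_lincomb fA surj_eps exf; split.
  move=> y; have [x <-] := surj_eps y; have [v <-] := is_basis_surj basisM x.
  by exists v.
move=> v /=; split=> [/exf[x fx] | [w <-]].
  have [w xE] := is_basis_surj basisL x.
  by exists w; apply: is_basis_inj basisM _ _ _; rewrite -fA xE.
by apply/exf; exists (lincomb bL w); rewrite fA.
Qed.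

End Coordinates.

Theorem lemma3 (R : comPzRingType) (n : nat) (hn : (1 <= n)%N) (N : lmodType R)
    (F G : nat -> lmodType R)
    (alpha : forall i : nat, {linear F i.+1 -> F i})
    (beta : forall i : nat, {linear G i.+1 -> G i})
    (epsF : {linear F 0%N -> N}) (epsG : {linear G 0%N -> N})
    (hF : truncated_free_resolution n alpha epsF)
    (hG : truncated_free_resolution n beta epsG) :
  freely_stably_equiv (alpha n.-1) (beta n.-1).
Proof.
case: hF => freeF surjF exF0 exF; case: hG => freeG surjG exG0 exG.
have : (n.-1 < n)%N by rewrite prednK.
elim: n.-1 => [|k IHk] lt_kn a q c r bM bM' bP bP' A B hbM hbM' hbP hbP' hA hB;
  apply/freely_stably_equiv_mxE.
  (* Base case: [alpha 0] and [beta 0] are both presentations of [N]. *)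
  exact: presents_stably_equivmx
    (exact_at_presents hbM hbM' hA surjF exF0)
    (exact_at_presents hbP hbP' hB surjG exG0).
have le_kn : (k <= n)%N by rewrite ltnW // ltnW.
(* The given bases cover levels [k.+2] and [k.+1]; bases at level [k] give matrices to [alpha k] and
   [beta k], and the induction hypothesis holds for all bases. *)
have [m [bF hbF]] := freeF k le_kn; have [m' [bG hbG]] := freeG k le_kn.
have [A1 hA1] := is_matrix_of_exists bM' (alpha k) hbF.
have [B1 hB1] := is_matrix_of_exists bP' (beta k) hbG.
apply: stably_equivmx_next (exact_at_mx hbM hbM' hbF hA hA1 (exF k lt_kn))
  (exact_at_mx hbP hbP' hbG hB hB1 (exG k lt_kn)) _.
by apply/freely_stably_equiv_mxE; exact: (IHk (ltnW lt_kn)) hA1 hB1.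
Qed.
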